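(* (Soundness) For any set $\Phi\cup\{\varphi\}\subseteq Fm$: if $\Phi\vdash_L\varphi$ then $\Phi\Vdash\varphi$.
   Context: Let $V=\{x_0,x_1,\dots\}$ be an infinite set of propositional variables; $Fm$ is generated from $V$ by $\bot$, binary $\rightarrow,\vee,\wedge$ and unary $\square$. Abbreviations: $\neg\varphi:=\varphi\rightarrow\bot$, $\varphi\equiv\psi:=\square(\varphi\rightarrow\psi)\wedge\square(\psi\rightarrow\varphi)$; $\chi[x:=\varphi]$ is substitution of $\varphi$ for $x$ in $\chi$. The logic L: axioms are all formulas of the forms (i) substitution instances (variables replaced by arbitrary formulas of $Fm$) of intuitionistic propositional tautologies; (ii) $\square\varphi\rightarrow\varphi$; (iii) $\square(\varphi\rightarrow\psi)\rightarrow(\square(\psi\rightarrow\chi)\rightarrow\square(\varphi\rightarrow\chi))$; (iv) $\square(\varphi\vee\psi)\rightarrow(\square\varphi\vee\square\psi)$; rules are Modus Ponens and Axiom Necessitation (from an axiom $\varphi$ of form (i)–(iv) infer $\square\varphi$); additionally all formulas $\varphi\vee\neg\varphi$ and $(\varphi\equiv\psi)\rightarrow(\chi[x:=\varphi]\equiv\chi[x:=\psi])$ are theorems (usable in derivations, not subject to Axiom Necessitation). $\Phi\vdash_L\varphi$: $\varphi$ is derivable from $\Phi$ in L. Semantics: a Heyting algebra $(M,f_\top,f_\bot,f_\vee,f_\wedge,f_\rightarrow)$ is a bounded lattice (top $f_\top$, bottom $f_\bot$, order $\le$) with $f_\rightarrow(m,m')$ the greatest $m''$ with $f_\wedge(m,m'')\le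 m'$; a filter is a non-empty upward closed $F\subseteq M$ closed under $f_\wedge$ with $f_\bot\notin F$; an ultrafilter is a maximal filter. A model $\mathcal{M}=(M,\mathit{TRUE},f_\top,f_\bot,f_\rightarrow,f_\vee,f_\wedge,f_\square)$ is a Heyting algebra with an ultrafilter $\mathit{TRUE}$ and unary $f_\square$ such that for all $m,m',m''$: (1) $f_\square(m)\le m$; (2) $f_\square(f_\rightarrow(m,m'))\le f_\rightarrow(f_\square(f_\rightarrow(m',m'')),f_\square(f_\rightarrow(m,m'')))$; (3) $f_\square(f_\vee(m,m'))\le f_\vee(f_\square(m),f_\square(m'))$; (4) $f_\square(m)\in\mathit{TRUE}\iff m=f_\top$. An assignment $\gamma:V\to M$ extends homomorphically to $Fm$ ($\gamma(\bot)=f_\bot$, $\gamma(\square\varphi)=f_\square(\gamma(\varphi))$, $\gamma(\varphi*\psi)=f_*(\gamma(\varphi),\gamma(\psi))$). $(\mathcal{M},\gamma)\vDash\varphi$ iff $\gamma(\varphi)\in\mathit{TRUE}$; $\Phi\Vdash\varphi$ iff every interpretation $(\mathcal{M},\gamma)$ satisfying all of $\Phi$ satisfies $\varphi$. *)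

(* Defs.v *)
From HB Require Import structures.
From mathcomp Require Import all_boot all_order.
From mathcomp Require Import boolp classical_sets.

Set Implicit Arguments.
Unset Strict Implicit.
Unset Printing Implicit Defensive.

Local Open Scope classical_set_scope.

(* The propositional variable [x_n] is represented by its index [n]. *)

(* Formulas of intuitionistic propositional logic, i.e. without modality. *)
Inductive pfm : Type :=
| PVar of nat
| PBot
| PImp of pfm & pfm
| POr of pfm & pfm
| PAnd of pfm & pfm.

Declare Scope pfm_scope.
Delimit Scope pfm_scope with P.
Bind Scope pfm_scope with pfm.
Notation "p ==> q" := (PImp p q) : pfm_scope.
Notation "p \/ q" := (POr p q) : pfm_scope.
Notation "p /\ q" := (PAnd p q) : pfm_scope.

(* A standard Hilbert calculus for intuitionistic propositional logic; its
   theorems are the intuitionistic tautologies. *)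
Inductive ipc_taut : pfm -> Prop :=
| ipc_K p q : ipc_taut (p ==> (q ==> p))
| ipc_S p q r : ipc_taut ((p ==> (q ==> r)) ==> ((p ==> q) ==> (p ==> r)))
| ipc_andI p q : ipc_taut (p ==> (q ==> (p /\ q)))
| ipc_andEl p q : ipc_taut ((p /\ q) ==> p)
| ipc_andEr p q : ipc_taut ((p /\ q) ==> q)
| ipc_orIl p q : ipc_taut (p ==> (p \/ q))
| ipc_orIr p q : ipc_taut (q ==> (p \/ q))
| ipc_orE p q r : ipc_taut ((p ==> r) ==> ((q ==> r) ==> ((p \/ q) ==> r)))
| ipc_botE p : ipc_taut (PBot ==> p)
| ipc_MP p q : ipc_taut (p ==> q) -> ipc_taut p -> ipc_taut q.

Inductive fm : Type :=
| Var of nat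
| Bot
| Imp of fm & fm
| Or of fm & fm
| And of fm & fm
| Box of fm.

Definition Neg (p : fm) : fm := Imp p Bot.
Definition Equ (p q : fm) : fm := And (Box (Imp p q)) (Box (Imp q p)).

Declare Scope fm_scope.
Delimit Scope fm_scope with F.
Bind Scope fm_scope with fm.
Notation "p ==> q" := (Imp p q) : fm_scope.
Notation "p \/ q" := (Or p q) : fm_scope.
Notation "p /\ q" := (And p q) : fm_scope.
Notation "~ p" := (Neg p) : fm_scope.
Notation "□ p" := (Box p) (at level 35, right associativity) : fm_scope.
Notation "p ≡ q" := (Equ p q) (at level 70, no associativity) : fm_scope.

(* The substitution instance of [p] that replaces each variable [x_n] by the
   modal formula [s n]. *)
Fixpoint inst (s : nat -> fm) (p : pfm) : fm :=
  match p with
  | PVar n => s n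
  | PBot => Bot
  | PImp p q => Imp (inst s p) (inst s q)
  | POr p q => Or (inst s p) (inst s q)
  | PAnd p q => And (inst s p) (inst s q)
  end.

(* [subst x p c] is c[x := p]. *)
Fixpoint subst (x : nat) (p c : fm) : fm :=
  match c with
  | Var n => if n == x then p else Var n
  | Bot => Bot
  | Imp c1 c2 => Imp (subst x p c1) (subst x p c2)
  | Or c1 c2 => Or (subst x p c1) (subst x p c2)
  | And c1 c2 => And (subst x p c1) (subst x p c2)
  | Box c1 => Box (subst x p c1)
  end.

Inductive L_axiom : fm -> Prop :=
| ax_int (s : nat -> fm) (p : pfm) : ipc_taut p -> L_axiom (inst s p)
| ax_box_elim p : L_axiom (□ p ==> p)
| ax_box_trans p q r :
    L_axiom (□ (p ==> q) ==> (□ (q ==> r) ==> □ (p ==> r)))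
| ax_box_or p q : L_axiom (□ (p \/ q) ==> (□ p \/ □ q)).

(* Necessitation applies to the axioms only, not to arbitrary theorems, and
   neither to instances of excluded middle nor to the substitution
   principle. *)
Inductive L_derives (Phi : set fm) : fm -> Prop :=
| L_hyp p : Phi p -> L_derives Phi p
| L_ax p : L_axiom p -> L_derives Phi p
| L_tnd p : L_derives Phi (p \/ ~ p)
| L_subst p q c x :
    L_derives Phi ((p ≡ q) ==> (subst x p c ≡ subst x q c))
| L_MP p q : L_derives Phi (p ==> q) -> L_derives Phi p -> L_derives Phi q
| L_AN p : L_axiom p -> L_derives Phi (□ p).

(* Carriers are [choiceType]s with a boolean order, as for every lattice of
   the library. In the classical setting of [boolp] this is no
   restriction: every type is a [choiceType] ([gen_eqMixin],
   [gen_choiceMixin]) and every relation is boolean ([asbool]). *)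
HB.mixin Record isHeyting (d : Order.disp_t) (M : Type)
    of Order.TBLattice d M := {
  himp : M -> M -> M;
  himp_meet : forall m m' : M,
    (Order.meet m (himp m m') <= m')%O;
  himp_greatest : forall m m' m'' : M,
    (Order.meet m m'' <= m')%O -> (m'' <= himp m m')%O
}.

#[short(type="heytingType")]
HB.structure Definition Heyting (d : Order.disp_t) :=
  { M of isHeyting d M & Order.TBLattice d M }.

Section Filters.
Context {d : Order.disp_t} {M : heytingType d}.

Definition is_filter (F : set M) : Prop :=
  [/\ F !=set0,
      forall m m', F m -> (m <= m')%O -> F m',
      forall m m', F m -> F m' -> F (Order.meet m m')
    & ~ F (Order.bottom)].

Definition is_ultrafilter (F : set M) : Prop :=
  is_filter F /\ forall G : set M, is_filter G -> F `<=` G -> G = F.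

End Filters.

Record model := Model {
  model_disp : Order.disp_t;
  carrier :> heytingType model_disp;
  TRUE : set carrier;
  fbox : carrier -> carrier;
  TRUE_ultra : is_ultrafilter TRUE;
  fbox_le : forall m, (fbox m <= m)%O;
  fbox_trans : forall m m' m'',
    (fbox (himp m m') <= himp (fbox (himp m' m'')) (fbox (himp m m'')))%O;
  fbox_or : forall m m',
    (fbox (Order.join m m') <= Order.join (fbox m) (fbox m'))%O;
  fbox_TRUE : forall m, TRUE (fbox m) <-> m = Order.top
}.

Section Eval.
Context (M : model) (g : nat -> M).

Fixpoint eval (p : fm) : M :=
  match p with
  | Var n => g n
  | Bot => Order.bottom
  | Imp p q => himp (eval p) (eval q)
  | Or p q => Order.join (eval p) (eval q)
  | And p q => Order.meet (eval p) (eval q)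
  | Box p => fbox (eval p)
  end.

End Eval.

Definition satisfies (M : model) (g : nat -> M) (p : fm) : Prop :=
  TRUE (eval g p).

Definition entails (Phi : set fm) (p : fm) : Prop :=
  forall (M : model) (g : nat -> M),
    (forall q, Phi q -> satisfies g q) -> satisfies g p.

(* Main.v *)
(** In every model an axiom evaluates to the top element, hence its box is true
    by condition (4). The remaining theorems need not evaluate to the top: they
    are true because an ultrafilter contains each element or its
    pseudocomplement, and because, again by (4), [p ≡ q] is true exactly when
    [p] and [q] have the same value. *)

Require Import Defs.
From mathcomp Require Import all_boot all_order.
From mathcomp Require Import boolp classical_sets.

Set Implicit Arguments.
Unset Strict Implicit.

Import Order.TTheory.
Local Open Scope order_scope.

Section HeytingTheory.
Context {d : Order.disp_t} {M : heytingType d}.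
Implicit Types a b c : M.

Lemma le_himp a b c : (c <= himp a b) = (a `&` c <= b).
Proof.
apply/idP/idP => [le_c|]; last exact: himp_greatest.
exact: le_trans (leI2 (lexx a) le_c) (himp_meet a b).
Qed.

(** Since [a] is its own meet with [\top], this is the case [c = \top] of [le_himp]. *)
Lemma himp_eq_top a b : (himp a b = \top) <-> (a <= b).
Proof. by rewrite -[X in X <= _]meetx1 -le_himp le1x; split=> /eqP. Qed.

Lemma himpxx a : himp a a = \top.
Proof. exact/himp_eq_top. Qed.

Lemma mp_le a b c : c <= himp a b -> c <= a -> c <= b.
Proof. by rewrite le_himp => le_b le_a; move: le_b; rewrite (meet_r le_a). Qed.

Lemma himp_distr a b c : himp a (himp b c) <= himp (himp a b) (himp a c).
Proof.
rewrite !le_himp; set x := _ `&` _.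
(* The meet [x] plays the role of a context: each hypothesis lies above it, and [mp_le] is modus
   ponens inside it. *)
have xa : x <= a by rewrite /x leIl.
have xab : x <= himp a b by rewrite /x meetCA leIl.
have xabc : x <= himp a (himp b c) by rewrite /x meetA leIr.
exact: mp_le (mp_le xabc xa) (mp_le xab xa).
Qed.

Lemma himp_orE a b c : himp a c <= himp (himp b c) (himp (a `|` b) c).
Proof.
have mp (x y z : M) : y <= himp x z -> y `&` x <= z by rewrite le_himp meetC.
(* Moving the join alone to the left of [<=] lets [leUx] split the goal into the cases [a] and
   [b]. *)
rewrite !le_himp meetC -le_himp leUx !le_himp.
by apply/andP; split; apply: mp; rewrite ?leIl ?leIr.
Qed.

End HeytingTheory.

Section UltrafilterTheory.
Context {d : Order.disp_t} {M : heytingType d} {F : set M}.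
Context (ultraF : is_ultrafilter F).
Implicit Types a b : M.

Lemma ultrafilter_le a b : F a -> a <= b -> F b.
Proof. by case: ultraF => -[_ up _ _] _; apply: up. Qed.

Lemma ultrafilter_meet a b : F (a `&` b) <-> F a /\ F b.
Proof.
split=> [Fab|[Fa Fb]]; last by case: ultraF => -[_ _ meetF _] _; apply: meetF.
by split; apply: ultrafilter_le Fab _; rewrite ?leIl ?leIr.
Qed.

(** If adjoining [a] to [F] gives a proper filter, maximality puts [a] in [F]; otherwise some
    element of [F] has meet [\bot] with [a], hence lies below the pseudocomplement of [a]. *)
Lemma ultrafilter_neg a : F a \/ F (himp a \bot).
Proof.
have [[[f0 Ff0] _ _ _] maxF] := ultraF.
(* the filter generated by [F] and [a], unless it is improper *)
pose G : set M := fun m => exists2 f, F f & a `&` f <= m.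
have [[f Ff le_bot]|nGbot] := pselect (G \bot).
  by right; apply: ultrafilter_le Ff _; rewrite le_himp.
have filterG : is_filter G.
  split=> //.
  - by exists a, f0 => //; rewrite leIl.
  - by move=> m m' [f Ff le_m] le_m'; exists f => //; apply: le_trans le_m'.
  - move=> m m' [f Ff le_m] [f' Ff' le_m']; exists (f `&` f').
      exact/ultrafilter_meet.
    rewrite lexI (le_trans (leI2 (lexx a) (leIl f f')) le_m).
    exact: le_trans (leI2 (lexx a) (leIr f' f)) le_m'.
left; rewrite -(maxF G filterG).
  by exists f0 => //; rewrite leIl.
by move=> f Ff; exists f => //; rewrite leIr.
Qed.

Lemma ultrafilter_himp a b : F (himp a b) <-> (F a -> F b).
Proof.
split=> [Fab Fa|FaFb].
  have /ultrafilter_le : F (a `&` himp a b) by apply/ultrafilter_meet.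
  by apply; apply: himp_meet.
(* Both [b] and the pseudocomplement of [a] lie below [himp a b], and one of them is in [F]. *)
have [/FaFb Fb|Fna] := ultrafilter_neg a.
  by apply: ultrafilter_le Fb _; rewrite le_himp leIr.
apply: ultrafilter_le Fna _; rewrite le_himp.
exact: le_trans (himp_meet _ _) (le0x _).
Qed.

End UltrafilterTheory.

Section Soundness.
Context (M : model) (g : nat -> M).

Lemma eval_ipc_taut s p : ipc_taut p -> eval g (inst s p) = \top.
Proof.
elim=> {p} /=.
- by move=> p q; apply/himp_eq_top; rewrite le_himp leIr.
- by move=> p q r; apply/himp_eq_top; apply: himp_distr.
- by move=> p q; apply/himp_eq_top; rewrite le_himp meetC.
- by move=> p q; apply/himp_eq_top; rewrite leIl.
- by move=> p q; apply/himp_eq_top; rewrite leIr.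
- by move=> p q; apply/himp_eq_top; rewrite leUl.
- by move=> p q; apply/himp_eq_top; rewrite leUr.
- by move=> p q r; apply/himp_eq_top; apply: himp_orE.
- by move=> p; apply/himp_eq_top; rewrite le0x.
- move=> p q _ /himp_eq_top le_pq _ p1; apply/eqP.
  by rewrite -le1x -p1.
Qed.

Lemma eval_L_axiom p : L_axiom p -> eval g p = \top.
Proof.
case=> {p} [s p|p|p q r|p q] /=; first exact: eval_ipc_taut.
- by apply/himp_eq_top; apply: fbox_le.
- by apply/himp_eq_top; apply: fbox_trans.
- by apply/himp_eq_top; apply: fbox_or.
Qed.

Lemma satisfies_Equ p q : satisfies g (Equ p q) <-> eval g p = eval g q.
Proof.
rewrite /satisfies /=; split.
  case/(ultrafilter_meet (TRUE_ultra M)).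
  move=> /fbox_TRUE/himp_eq_top le_pq /fbox_TRUE/himp_eq_top le_qp.
  by apply: le_anti; rewrite le_pq.
move=> ->; apply/(ultrafilter_meet (TRUE_ultra M)).
by split; apply/fbox_TRUE; apply: himpxx.
Qed.

(** Evaluation is compositional, so equality of values passes through every connective, including
    [Box]; agreement in truth alone would not pass through [fbox]. *)
Lemma eval_subst x p q c :
  eval g p = eval g q -> eval g (subst x p c) = eval g (subst x q c).
Proof.
move=> eq_pq.
by elim: c => //= [n|c -> c' ->|c -> c' ->|c -> c' ->|c ->] //; case: ifP.
Qed.

End Soundness.

Theorem theorem3p8 (Phi : set fm) (phi : fm) :
  L_derives Phi phi -> entails Phi phi.
Proof.
move=> der M g satPhi; have ultra := TRUE_ultra M.
elim: der => {phi} [p|p ax|p|p q c x|p q _ satpq _ satp|p ax].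
- exact: satPhi.
(* The truth of an axiom is obtained from that of its box, which lies below it. *)
- have Tbox : TRUE (fbox (eval g p)) by apply/fbox_TRUE; apply: eval_L_axiom.
  exact (ultrafilter_le ultra Tbox (fbox_le _)).
- rewrite /satisfies /=; have [Tp|Tnp] := ultrafilter_neg ultra (eval g p).
    by apply: (ultrafilter_le ultra Tp); rewrite leUl.
  by apply: (ultrafilter_le ultra Tnp); rewrite leUr.
- apply/(ultrafilter_himp ultra) => /satisfies_Equ eq_pq.
  by apply/satisfies_Equ; apply: eval_subst.
- exact: (iffLR (ultrafilter_himp ultra _ _) satpq).
- by apply/fbox_TRUE; apply: eval_L_axiom.
Qed.
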